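(* Let $k,N\ge1$ be integers, let $\Gamma:=\Gamma_0(N^2)\cap\Gamma_1(N)$ and $S:=\begin{pmatrix}0&-1\\1&0\end{pmatrix}$. Let $f_1,\ldots,f_g$ be a basis of the $\mathbb Z$-module $S_k(\Gamma,\mathbb Z)$ (it is also a basis of $S_k(\Gamma)$), and let $W\in\mathrm{GL}_g(\mathbb C)$ be the matrix with $f_j|W_{N^2}=\sum_{i=1}^g W_{j,i}f_i$ for all $1\le j\le g$. Then: 1. The map $\beta: S_k(\Gamma)\to S_k(\Gamma(N))$, $f\mapsto N^{k/2}\cdot f|\begin{pmatrix}1&0\\0&N\end{pmatrix}$, is an isomorphism of complex vector spaces, and on $q$-expansions it satisfies $\beta\big(\sum_{n\ge1}a_nq^n\big)=\sum_{n\ge1}a_nq_N^n$. 2. The cusp forms $h_j:=\beta(f_j)$, $1\le j\le g$, form a basis of the $\mathbb Z$-module $S_k(\Gamma(N),\mathbb Z)$. 3. $\beta(f|W_{N^2})=N^k\,\beta(f)|S$ for all $f\in S_k(\Gamma)$, and \[ h_j|S=\sum_{i=1}^g N^{-k}\,W_{j,i}\,h_i\qquad(1\le j\le g). \]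
   Context: For $f:\mathfrak H\to\mathbb C$ on the upper half plane and $\gamma=\begin{pmatrix}a&b\\ c&d\end{pmatrix}\in\mathrm{GL}_2^+(\mathbb R)$, $(f|\gamma)(\tau)=\det(\gamma)^{k/2}(c\tau+d)^{-k}f(\gamma\tau)$. $S_k(\Gamma')$ is the complex vector space of weight $k$ cusp forms on a congruence subgroup $\Gamma'$. Forms on $\Gamma(N)$ have $q$-expansions in $q_N=e^{2\pi i\tau/N}$, and forms on $\Gamma=\Gamma_0(N^2)\cap\Gamma_1(N)$ have $q$-expansions in $q=e^{2\pi i\tau}$. $S_k(\Gamma',\mathbb Z)$ is the $\mathbb Z$-module of cusp forms in $S_k(\Gamma')$ all of whose $q$-expansion coefficients are integers. For a positive integer $M$ and a congruence subgroup $\Gamma_1(M)\subseteq\Gamma'\subseteq\Gamma_0(M)$, the Atkin--Lehner operator on $S_k(\Gamma')$ is $f|W_M:=M^{k/2}\,f|\begin{pmatrix}0&-1\\ M&0\end{pmatrix}$; here it is used with $M=N^2$. *)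

(* Defs.v *)
From HB Require Import structures.
From mathcomp Require Import all_boot all_order all_algebra.
From mathcomp Require Import complex.
From mathcomp Require Import all_classical all_reals all_analysis.
From mathcomp Require Import ring lra.
Import Order.TTheory GRing.Theory Num.Theory.
Import numFieldNormedType.Exports.

Set Implicit Arguments.
Unset Strict Implicit.
Unset Printing Implicit Defensive.

Local Open Scope classical_set_scope.
Local Open Scope ring_scope.
Local Open Scope complex_scope.

Definition mat2 (K : pzRingType) (a b c d : K) : 'M[K]_2 :=
  \matrix_(i, j) (nth [::] [:: [:: a; b]; [:: c; d]] i)`_j.

Record upper_half (R : realType) := UpperHalf {
  uh_val :> R[i];
  uh_im_gt0 : 0 < complex.Im uh_val
}.

HB.instance Definition _ (R : realType) := [isSub for @uh_val R].

(* The default value tau of insubd is never reached when 0 < \det A, see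
   val_mobius below. *)
Definition mobius (R : realType) (A : 'M[R]_2) (tau : upper_half R) :
    upper_half R :=
  insubd tau (((A 0 0)%:C * val tau + (A 0 1)%:C) /
              ((A 1 0)%:C * val tau + (A 1 1)%:C)).

Lemma val_mobius (R : realType) (A : 'M[R]_2) (tau : upper_half R) :
  0 < \det A ->
  val (mobius A tau) = ((A 0 0)%:C * val tau + (A 0 1)%:C) /
                       ((A 1 0)%:C * val tau + (A 1 1)%:C).
Proof.
move=> detA; rewrite val_insubd ifT //.
case: tau => -[x y] /= y0; move: detA.
have -> : \det A = A 0 0 * A 1 1 - A 0 1 * A 1 0.
  rewrite (expand_det_row _ 0) !big_ord_recl big_ord0 /cofactor !det_mx11 !mxE.
  rewrite /= expr0 expr1 mul1r mulN1r addr0 mulrN.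
  by do 3?[congr (_ - _) | congr (_ * _)]; congr (A _ _); apply/val_inj.
move: (A 0 0) (A 0 1) (A 1 0) (A 1 1) => a b c d detA.
rewrite /in_mem /= !(mul0r, mulr0, subr0, addr0, add0r).
set D := _ ^+ 2 + _ ^+ 2.
have D0 : 0 < D.
  rewrite lt_neqAle addr_ge0 ?sqr_ge0// andbT eq_sym paddr_eq0 ?sqr_ge0//.
  rewrite !sqrf_eq0 mulf_eq0 (gt_eqF y0) orbF andbC.
  by apply/negP => /andP[/eqP c0 /eqP]; rewrite c0 => d0; move: detA;
    rewrite c0; nra.
rewrite [X in 0 < X](_ : _ = (a * d - b * c) * y / D); last by field; rewrite gt_eqF.
by rewrite divr_gt0// mulr_gt0.
Qed.

Definition slash (R : realType) (k : nat) (f : upper_half R -> R[i])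
    (A : 'M[R]_2) : upper_half R -> R[i] :=
  fun tau => (\det A `^ (k%:R / 2))%:C *
    ((A 1 0)%:C * val tau + (A 1 1)%:C) ^- k * f (mobius A tau).

Definition toR (R : realType) (g : 'M[int]_2) : 'M[R]_2 :=
  map_mx intr g.

Definition SL2Z : set 'M[int]_2 := [set g | \det g = 1].

Definition Gamma0 (M : nat) : set 'M[int]_2 :=
  [set g | SL2Z g /\ (M%:Z %| g 1%R 0%R)%Z].

Definition Gamma1 (M : nat) : set 'M[int]_2 :=
  [set g | [/\ SL2Z g, (M%:Z %| g 1%R 0%R)%Z, (g 0%R 0%R = 1 %[mod M%:Z])%Z
             & (g 1%R 1%R = 1 %[mod M%:Z])%Z]].

Definition Gamma (N : nat) : set 'M[int]_2 :=
  [set g | SL2Z g /\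
    forall i j, (g i j = (1%:M%R : 'M[int]_2) i j %[mod N%:Z])%Z].

(* Complex differentiability at each point: the limit defining derivable is
   over increments h in R[i]. Only the values of f near tau matter, so the
   extension of f outside the upper half plane by f tau is harmless. *)
Definition holomorphic (R : realType) (f : upper_half R -> R[i]) : Prop :=
  forall tau : upper_half R,
    @derivable R[i] R[i]^o R[i]^o (fun z => f (insubd tau z)) (val tau) 1.

Definition cexp (R : realType) (z : R[i]) : R[i] :=
  (expR (complex.Re z))%:C * (cos (complex.Im z) +i* sin (complex.Im z)).

(* q_h = exp (2 pi i tau / h) *)
Definition qpar (R : realType) (h : nat) (tau : upper_half R) : R[i] :=
  cexp ((0 +i* (2 * pi)) * val tau / h%:R).

(* f = sum_(n >= 1) a_n q_h^n on the upper half plane; a_0 is not used. *)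
Definition has_qexp (R : realType) (h : nat) (a : nat -> R[i])
    (f : upper_half R -> R[i]) : Prop :=
  forall tau : upper_half R,
    (fun m : nat => \sum_(1 <= n < m) a n * qpar h tau ^+ n : R[i]^o) @ \oo -->
      (f tau : R[i]^o).

(* S_k(G): f vanishes at the cusp alpha(oo) when f | alpha has a Fourier
   expansion, in some q_h with h >= 1, without terms of index n <= 0. *)
Definition cusp_form (R : realType) (k : nat) (G : set 'M[int]_2) :
    set (upper_half R -> R[i]) :=
  [set f | [/\ holomorphic f,
    forall g, G g -> slash k f (toR R g) = f
    & forall alpha, SL2Z alpha -> exists h : nat, (0 < h)%N /\
        exists a : nat -> R[i], has_qexp h a (slash k f (toR R alpha))]].

(* S_k(G, Z), for forms on G whose q-expansions are in the parameter q_h. *)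
Definition cusp_form_int (R : realType) (k : nat) (G : set 'M[int]_2)
    (h : nat) : set (upper_half R -> R[i]) :=
  [set f | cusp_form k G f /\
    exists a : nat -> int, has_qexp h (fun n => (a n)%:~R) f].

Definition Zbasis (V : zmodType) (L : set V) (g : nat) (f : 'I_g -> V) : Prop :=
  [/\ forall i, L (f i),
      forall c : 'I_g -> int, \sum_i f i *~ c i = 0 -> forall i, c i = 0
    & forall v, L v -> exists c : 'I_g -> int, v = \sum_i f i *~ c i].

Definition linear_iso (K : pzRingType) (U V : lmodType K) (A : set U)
    (B : set V) (phi : U -> V) : Prop :=
  (forall (c : K) (u v : U), A u -> A v ->
     phi (c *: u + v) = c *: phi u + phi v) /\
  set_bij A B phi.

Definition atkin_lehner (R : realType) (k M : nat)
    (f : upper_half R -> R[i]) : upper_half R -> R[i] :=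
  (M%:R `^ (k%:R / 2) : R)%:C *: slash k f (mat2 0 (- 1) M%:R 0).

Definition beta (R : realType) (k N : nat)
    (f : upper_half R -> R[i]) : upper_half R -> R[i] :=
  (N%:R `^ (k%:R / 2) : R)%:C *: slash k f (mat2 1 0 0 N%:R).

(* Main.v *)
Require Import Defs.
From HB Require Import structures.
From mathcomp Require Import all_boot all_order all_algebra.
From mathcomp Require Import complex.
From mathcomp Require Import all_classical all_reals all_analysis.
From mathcomp Require Import ring lra.
Import Order.TTheory GRing.Theory Num.Theory.
Import numFieldNormedType.Exports.

(** Slashing by the diagonal matrix diag(1, N) is, up to the scalar put into
    beta, the substitution tau |-> tau / N ([betaE]). Everything follows from
    three facts about this substitution.

    - It conjugates the two groups into each other: a matrix (a b; c d) becomes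
      (a b/N; Nc d), which turns the congruences that define Gamma(N) into
      those that define the intersection of Gamma_0(N^2) and Gamma_1(N)
      ([Gamma_conj], [Gamma0_Gamma1_conj]). So beta preserves invariance, and
      its inverse, a multiple of slashing by diag(N, 1), does so too.
    - It keeps the condition at the cusps. For an integral M of positive
      determinant and alpha in SL_2(Z), M alpha = alpha' T with alpha' in
      SL_2(Z) and T integral upper triangular ([int_mat2_upper]); so the
      expansion of f | M at the cusp alpha(oo) is the one of f at alpha'(oo)
      composed with an affine map tau |-> (A tau + B) / D, and this only sends
      q_h to a root of unity times q_(Dh)^A ([vanishes_at_cusps_slash]).
    - It identifies q_N with q, because exp (2 pi i tau / N) is the value of
      exp (2 pi i tau) at tau / N. So F and beta F have the same coefficients
      ([has_qexp_beta]), and integrality is the same condition for both.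

    Hence beta is a linear bijection between the two spaces of cusp forms that
    matches their integral structures, and it maps bases to bases. The relation
    with the Atkin-Lehner operator is the matrix identity
    (0 -1; N^2 0) diag(1, N) = N diag(1, N) S, in which the scalar N acts
    trivially and N^k comes from the normalization ([beta_atkin_lehner]); the
    formula for h_j | S is the image under beta of the one for f_j | W. *)

Set Implicit Arguments.
Unset Strict Implicit.
Unset Printing Implicit Defensive.

Local Open Scope classical_set_scope.
Local Open Scope ring_scope.
Local Open Scope complex_scope.

(** * Two by two matrices *)

Lemma mat2E (K : pzRingType) (a b c d : K) :
  (mat2 a b c d 0 0 = a) * (mat2 a b c d 0 1 = b) *
  (mat2 a b c d 1 0 = c) * (mat2 a b c d 1 1 = d).
Proof. by rewrite !mxE. Qed.

Lemma mat2_eta (K : pzRingType) (A : 'M[K]_2) :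
  A = mat2 (A 0 0) (A 0 1) (A 1 0) (A 1 1).
Proof.
apply/matrixP => i j; rewrite !mxE.
by case: i => -[|[|//]] i; case: j => -[|[|//]] j;
  congr (A _ _); apply/val_inj.
Qed.

Lemma mulmx2E (K : pzRingType) (A B : 'M[K]_2) (i j : 'I_2) :
  (A *m B) i j = A i 0 * B 0 j + A i 1 * B 1 j.
Proof.
rewrite !mxE big_ord_recl big_ord1.
by congr (_ + A _ _ * B _ _); apply/val_inj.
Qed.

Lemma mul_mat2 (K : pzRingType) (a b c d a' b' c' d' : K) :
  mat2 a b c d *m mat2 a' b' c' d' =
  mat2 (a * a' + b * c') (a * b' + b * d') (c * a' + d * c') (c * b' + d * d').
Proof. by rewrite [LHS]mat2_eta !mulmx2E !mat2E. Qed.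

Lemma det_mat2 (K : comPzRingType) (A : 'M[K]_2) :
  \det A = A 0 0 * A 1 1 - A 0 1 * A 1 0.
Proof.
rewrite (expand_det_row _ 0) big_ord_recl big_ord1 /cofactor !det_mx11 !mxE.
rewrite /= expr0 expr1 mul1r mulN1r mulrN.
by do 2?[congr (_ - _) | congr (_ * _)]; congr (A _ _); apply/val_inj.
Qed.

Lemma toR_mat2 (R : realType) (a b c d : int) :
  toR R (mat2 a b c d) = mat2 a%:~R b%:~R c%:~R d%:~R.
Proof. by rewrite [LHS]mat2_eta !mxE. Qed.

Lemma det_toR (R : realType) (M : 'M[int]_2) : \det (toR R M) = (\det M)%:~R.
Proof. by rewrite det_map_mx. Qed.

Lemma toRM (R : realType) (M M' : 'M[int]_2) :
  toR R (M *m M') = toR R M *m toR R M'.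
Proof. exact: map_mxM. Qed.

Lemma toR_diag (R : realType) (a d : nat) :
  toR R (mat2 a%:Z 0 0 d%:Z) = mat2 a%:R 0 0 d%:R.
Proof. by rewrite toR_mat2. Qed.

(** * The slash action *)

(** The automorphy factor c tau + d. *)
Definition jfactor {R : realType} (A : 'M[R]_2) (tau : upper_half R) : R[i] :=
  (A 1 0)%:C * val tau + (A 1 1)%:C.

(** The imaginary part is c Im tau; if it is zero then c = 0, the factor is d,
    and d = 0 would make the determinant vanish. *)
Lemma jfactor_neq0 (R : realType) (A : 'M[R]_2) (tau : upper_half R) :
  0 < \det A -> jfactor A tau != 0.
Proof.
rewrite det_mat2 /jfactor; case: tau => -[x y] /= y0 dA.
apply/eqP => -[]; rewrite !(mul0r, mulr0, subr0, addr0, add0r) => e1 /eqP.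
rewrite mulf_eq0 (gt_eqF y0) orbF => /eqP c0.
by move: dA e1; rewrite c0 mul0r add0r => + d0; rewrite d0 !mulr0 subrr ltxx.
Qed.

(** The cocycle relation, which makes slash an action ([slashM]). *)
Lemma jfactorM (R : realType) (A B : 'M[R]_2) (tau : upper_half R) :
  0 < \det B ->
  jfactor (A *m B) tau = jfactor A (mobius B tau) * jfactor B tau.
Proof.
move=> dB; have := jfactor_neq0 tau dB.
rewrite /jfactor val_mobius // !mulmx2E.
by rewrite !rmorphD !rmorphM /= => ?; field.
Qed.

Lemma mobius_comp (R : realType) (A B : 'M[R]_2) (tau : upper_half R) :
  0 < \det A -> 0 < \det B ->
  mobius A (mobius B tau) = mobius (A *m B) tau.
Proof.
move=> dA dB; apply/val_inj; rewrite [RHS]val_mobius ?det_mulmx ?mulr_gt0//.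
have jB := jfactor_neq0 tau dB; have jA := jfactor_neq0 (mobius B tau) dA.
have := jfactorM A tau dB; rewrite {1}/jfactor => ->; rewrite val_mobius //.
rewrite -/(jfactor _ _) [in RHS]invfM mulrA mulrAC; congr (_ / _).
apply: (mulIf jB); rewrite mulrVK ?unitfE // val_mobius //.
move: jB; rewrite /jfactor !mulmx2E.
by rewrite !rmorphD !rmorphM /= => ?; field.
Qed.

Lemma slashM (R : realType) (k : nat) (F : upper_half R -> R[i])
    (A B : 'M[R]_2) : 0 < \det A -> 0 < \det B ->
  slash k (slash k F A) B = slash k F (A *m B).
Proof.
move=> dA dB; apply/funext => tau; rewrite /slash -mobius_comp //.
rewrite -!/(jfactor _ _) jfactorM // det_mulmx powRM ?ltW // rmorphM /=.
by rewrite exprMn invfM; ring.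
Qed.

(** The determinant of a scalar matrix c is c^2, so this evaluates the factor
    det^(k/2) of the slash operator there. *)
Lemma powR_half_sqr (R : realType) (c : R) (k : nat) : 0 <= c ->
  (c ^+ 2) `^ (k%:R / 2) = c ^+ k.
Proof.
move=> c0; rewrite -powR_mulrn // -powRrM mulrCA divff ?mulr1 ?pnatr_eq0 //.
by rewrite powR_mulrn.
Qed.

(** The factor (c^2)^(k/2) from the determinant cancels c^-k from the
    automorphy factor. *)
Lemma slash_scale (R : realType) (k : nat) (F : upper_half R -> R[i])
    (c : R) (A : 'M[R]_2) : 0 < c -> 0 < \det A ->
  slash k F (c *: A) = slash k F A.
Proof.
move=> c0 dA; have dcA : 0 < \det (c *: A) by rewrite detZ mulr_gt0 ?exprn_gt0.
have cC : c%:C != 0 :> R[i] by rewrite (fmorph_eq0 (real_complex R)) gt_eqF.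
apply/funext => tau; have jA := jfactor_neq0 tau dA.
have jfactorZ : jfactor (c *: A) tau = c%:C * jfactor A tau.
  by rewrite /jfactor !mxE !rmorphM /=; ring.
rewrite /slash -!/(jfactor _ _) jfactorZ; congr (_ * F _); last first.
  apply/val_inj; rewrite !val_mobius // -!/(jfactor _ _) jfactorZ !mxE.
  by rewrite !rmorphM /=; field; apply/andP.
rewrite detZ powRM ?exprn_ge0 ?ltW // powR_half_sqr ?ltW // rmorphM rmorphXn /=.
by rewrite exprMn; field; rewrite !expf_neq0.
Qed.

Lemma slash_lin (R : realType) (k : nat) (c : R[i]) (F G : upper_half R -> R[i])
    (A : 'M[R]_2) :
  slash k (c *: F + G) A = c *: slash k F A + slash k G A.
Proof.
by apply/funext => tau; rewrite /slash !fctE /= mulrDr mulrCA.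
Qed.

Lemma slashZ (R : realType) (k : nat) (c : R[i]) (F : upper_half R -> R[i])
    (A : 'M[R]_2) : slash k (c *: F) A = c *: slash k F A.
Proof. by apply/funext => tau; rewrite /slash /= mulrCA. Qed.

Lemma slash1 (R : realType) (k : nat) (F : upper_half R -> R[i]) :
  slash k F 1%:M = F.
Proof.
apply/funext => tau; rewrite /slash det1 powR1 !mxE /= mul0r add0r expr1n invr1.
rewrite !mul1r; congr F; apply/val_inj.
by rewrite val_mobius ?det1 // !mxE /= mul0r add0r mul1r addr0 divr1.
Qed.

(** * Upper triangular matrices and holomorphy *)

Lemma slash_upper (R : realType) (k : nat) (F : upper_half R -> R[i])
    (a b d : R) (tau : upper_half R) :
  slash k F (mat2 a b 0 d) tau =
  ((a * d) `^ (k%:R / 2))%:C * (d%:C) ^- k * F (mobius (mat2 a b 0 d) tau).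
Proof. by rewrite /slash det_mat2 !mat2E mulr0 subr0 mul0r add0r. Qed.

Lemma val_mobius_upper (R : realType) (a b d : R) (tau : upper_half R) :
  0 < a * d ->
  val (mobius (mat2 a b 0 d) tau) = (a%:C * val tau + b%:C) / d%:C.
Proof.
by move=> ad; rewrite val_mobius ?det_mat2 !mat2E ?mulr0 ?subr0 // mul0r add0r.
Qed.

(** Both sides keep their default values outside the upper half plane, because
    an affine map with a/d > 0 preserves the sign of the imaginary part. So the
    identity holds for every complex z, and holomorphy of the composition can
    be read off without any localization. *)
Lemma mobius_insubd (R : realType) (a b d : R) (tau : upper_half R) (z : R[i]) :
  0 < a * d ->
  mobius (mat2 a b 0 d) (insubd tau z) =
  insubd (mobius (mat2 a b 0 d) tau) ((a%:C * z + b%:C) / d%:C).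
Proof.
move=> ad; apply/val_inj; rewrite val_mobius_upper // val_insubd.
rewrite [RHS]val_insubd val_mobius_upper //.
suff -> : (0 < complex.Im ((a%:C * z + b%:C) / d%:C)) = (0 < complex.Im z).
  by case: ifP.
have d0 : d != 0 by apply: contraTneq ad => ->; rewrite mulr0 ltxx.
have -> : (a%:C * z + b%:C) / d%:C =
    ((a * complex.Re z + b) / d +i* (a / d * complex.Im z)).
  have dC : d%:C != 0 :> R[i] by rewrite (fmorph_eq0 (real_complex R)).
  apply: (mulIf dC); rewrite mulfVK //; case: z => x y /=.
  by apply/eqP; rewrite eq_complex /=; apply/andP; split; apply/eqP; field.
rewrite /= pmulr_rgt0 //; have -> : a / d = a * d / d ^+ 2 by field.
by rewrite divr_gt0 // exprn_even_gt0.
Qed.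

(** The chain rule for an affine substitution, over a generic field so that the
    normed structures on the complex numbers need not be unfolded. *)
Lemma derivable_affine_comp (K : numFieldType) (F : K^o -> K^o) (p q c z : K) :
  @derivable K K^o K^o F (p * z + q) 1 ->
  @derivable K K^o K^o (fun w => c * F (p * w + q)) z 1.
Proof.
move=> /derivable1_diffP dF; apply/derivable1_diffP.
pose u : K^o -> K^o := p *: (id : K^o -> K^o) + cst q.
have -> : (fun w => c * F (p * w + q)) = c *: (F \o u) by [].
by apply: differentiableZ; apply: differentiable_comp.
Qed.

Lemma holomorphic_upper (R : realType) (k : nat) (F : upper_half R -> R[i])
    (a b d : R) : 0 < a * d -> holomorphic F ->
  holomorphic (slash k F (mat2 a b 0 d)).
Proof.
move=> ad holF tau; set T := mat2 a b 0 d.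
have affE z : (a%:C * z + b%:C) / d%:C = (a%:C / d%:C) * z + b%:C / d%:C.
  by rewrite mulrDl mulrAC.
pose C : R[i] := ((a * d) `^ (k%:R / 2))%:C * (d%:C) ^- k.
pose G z := F (insubd (mobius T tau) z).
have -> : (fun z => slash k F T (insubd tau z)) =
    (fun z => C * G (a%:C / d%:C * z + b%:C / d%:C)).
  by apply/funext => z; rewrite slash_upper mobius_insubd // affE.
apply: (@derivable_affine_comp R[i] G).
rewrite -affE -(val_mobius_upper b tau ad).
exact: (holF (mobius T tau)).
Qed.

(** * Fourier expansions *)

Lemma cexpD (R : realType) (z w : R[i]) : cexp (z + w) = cexp z * cexp w.
Proof.
case: z w => [x y] [x' y']; rewrite /cexp /= expRD cosD sinD.
by apply/eqP; rewrite eq_complex /=; apply/andP; split; apply/eqP; ring.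
Qed.

Lemma cexp_nat (R : realType) (n : nat) (z : R[i]) :
  cexp (n%:R * z) = cexp z ^+ n.
Proof.
elim: n => [|n IHn]; last by rewrite exprSr -IHn -cexpD -natr1 mulrDl mul1r.
rewrite mul0r expr0 /cexp /= expR0 cos0 sin0; apply/eqP.
by rewrite eq_complex /= !(mul0r, mul1r, subr0, addr0, mulr0) !eqxx.
Qed.

(** The constant factor comes from the translation by B; it is a root of unity
    when B is an integer. *)
Lemma qpar_mobius_upper (R : realType) (h A D : nat) (B : R) (tau : upper_half R) :
  (0 < h)%N -> (0 < A)%N -> (0 < D)%N ->
  qpar h (mobius (mat2 A%:R B 0 D%:R) tau) =
  cexp ((0 +i* (2 * pi)) * B%:C / (D * h)%:R) * qpar (D * h) tau ^+ A.
Proof.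
move=> h0 A0 D0; rewrite /qpar val_mobius_upper ?mulr_gt0 ?ltr0n //.
rewrite -cexp_nat -cexpD !rmorph_nat natrM; congr cexp; field.
by rewrite !pnatr_eq0 -!lt0n h0 D0.
Qed.

(** Only the multiples n = A n' below m contribute, and these are the n' up to
    (m - 1) / A. For m = 0 both sums are empty. *)
Lemma sum_multiples (V : nmodType) (b : nat -> V) (A m : nat) : (0 < A)%N ->
  \sum_(1 <= n < m) (if (A %| n)%N then b (n %/ A)%N else 0) =
  \sum_(1 <= n < (m.-1 %/ A).+1) b n.
Proof.
move=> A0; case: m => [|m] /=; first by rewrite div0n !big_geq.
elim: m => [|m IHm]; first by rewrite div0n !big_geq.
rewrite big_nat_recr //= IHm divnS //; case: ifP => [Am|]; last by rewrite addr0.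
by rewrite /= add1n [RHS]big_nat_recr //= Am.
Qed.

Lemma cvg_scale (K : numFieldType) (s : nat -> K^o) (c l : K) :
  s @ \oo --> (l : K^o) -> (fun m => c * s m : K^o) @ \oo --> (c * l : K^o).
Proof. by move=> sl; apply: cvgM => //; exact: cvg_cst. Qed.

Lemma cvg_scaled_subseq (K : numFieldType) (s : nat -> K^o) (A : nat) (c l : K) :
  (0 < A)%N -> s @ \oo --> (l : K^o) ->
  (fun m => c * s (m.-1 %/ A).+1 : K^o) @ \oo --> (c * l : K^o).
Proof.
move=> A0 sl; apply: (@cvg_scale K (fun m => s (m.-1 %/ A).+1)).
apply: (@cvg_comp _ _ _ (fun m => (m.-1 %/ A).+1) s) sl.
apply/cvgnyPge => M; exists (M * A).+1 => // m /= Mm.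
by apply: leqW; rewrite leq_divRL // -ltnS (leq_trans Mm) // leqSpred.
Qed.

(** Substituting zeta q_(Dh)^A for q_h in the expansion of F leaves only
    exponents n A with n >= 1: the new coefficients are supported on the
    multiples of A, and the partial sums are a reindexing of the old ones. *)
Lemma has_qexp_upper (R : realType) (k h A D : nat) (B : R) (a : nat -> R[i])
    (F : upper_half R -> R[i]) :
  (0 < h)%N -> (0 < A)%N -> (0 < D)%N -> has_qexp h a F ->
  exists a', has_qexp (D * h) a' (slash k F (mat2 A%:R B 0 D%:R)).
Proof.
move=> h0 A0 D0 aF.
pose C : R[i] := ((A%:R * D%:R) `^ (k%:R / 2) : R)%:C * (D%:R%:C) ^- k.
pose zeta : R[i] := cexp ((0 +i* (2 * pi)) * B%:C / (D * h)%:R).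
pose b n : R[i] := C * (a n * zeta ^+ n).
exists (fun n => if (A %| n)%N then b (n %/ A)%N else 0) => tau.
rewrite slash_upper -/C; set tau' := mobius _ tau.
have := aF tau'; set s := (fun m => _) => s_cvg.
have -> : (fun m => \sum_(1 <= n < m)
      (if (A %| n)%N then b (n %/ A)%N else 0) * qpar (D * h) tau ^+ n : R[i]^o) =
    (fun m => C * s (m.-1 %/ A).+1).
  apply/funext => m; rewrite /s mulr_sumr -[RHS]sum_multiples //.
  apply: eq_bigr => n _; have [/divnK An|_] := boolP (A %| n)%N; last first.
    exact: mul0r.
  rewrite [in RHS]/tau' qpar_mobius_upper // -/zeta [in RHS]exprMn -exprM.
  by rewrite (mulnC A) An /b -!mulrA.
exact: cvg_scaled_subseq.
Qed.

Lemma has_qexp_scale (R : realType) (h : nat) (c : R[i]) (a : nat -> R[i])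
    (F : upper_half R -> R[i]) :
  has_qexp h a F -> has_qexp h (fun n => c * a n) (c *: F).
Proof.
move=> aF tau; have cF := @cvg_scale R[i] _ c _ (aF tau).
have -> : (fun m => \sum_(1 <= n < m) c * a n * qpar h tau ^+ n : R[i]^o) =
    (fun m => c * \sum_(1 <= n < m) a n * qpar h tau ^+ n).
  apply/funext => m; rewrite mulr_sumr; apply: eq_bigr => n _.
  by rewrite mulrA.
exact: cF.
Qed.

(** * The cusp condition *)

(** The Hermite normal form, with B not reduced. With A the gcd of the first
    column, the column divided by A is primitive and completes to alpha by
    Bezout coefficients; A is positive since the determinant of M does not
    vanish. *)
Lemma int_mat2_upper (M : 'M[int]_2) : 0 < \det M ->
  exists2 alpha, SL2Z alpha & exists (A D : nat) (B : int),
    [/\ (0 < A)%N, (0 < D)%N & M = alpha *m mat2 A%:Z B 0 D%:Z].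
Proof.
rewrite det_mat2; move: (M 0 0) (M 0 1) (M 1 0) (M 1 1) (mat2_eta M).
move=> a b c d -> detM.
have [u [v uvE]] := Bezoutz a c.
have /dvdzP[a' aE] := dvdz_gcdl a c; have /dvdzP[c' cE] := dvdz_gcdr a c.
move: uvE aE cE; rewrite /gcdz; set A := gcdn _ _ => uvE aE cE.
have A0 : (0 < A)%N.
  rewrite lt0n; apply: contraTneq detM => A0.
  by rewrite aE cE A0 !mulr0 mul0r subrr ltxx.
have bez : u * a' + v * c' = 1.
  apply: (@mulIf _ A%:Z); first by rewrite eqz_nat -lt0n.
  by rewrite mul1r -[RHS]uvE aE cE; ring.
have DE : (a' * d - c' * b) * A%:Z = a * d - b * c by rewrite aE cE; ring.
have D0 : 0 < a' * d - c' * b by rewrite -(pmulr_lgt0 _ (x := A%:Z)) ?DE.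
exists (mat2 a' (- v) c' u).
  by rewrite /SL2Z /= det_mat2 !mat2E -bez; ring.
exists A, (absz (a' * d - c' * b)%R), (u * b + v * d); split => //.
  by rewrite absz_gt0 gt_eqF.
rewrite mul_mat2 gtz0_abs // !mulr0 !addr0 -aE -cE.
by congr mat2; rewrite -[LHS]mul1r -bez; ring.
Qed.

(** The third clause of the definition of a cusp form. *)
Definition vanishes_at_cusps (R : realType) (k : nat)
    (F : upper_half R -> R[i]) : Prop :=
  forall alpha, SL2Z alpha -> exists h : nat, (0 < h)%N /\
    exists a : nat -> R[i], has_qexp h a (slash k F (toR R alpha)).

Lemma vanishes_at_cusps_slash (R : realType) (k : nat)
    (F : upper_half R -> R[i]) (M : 'M[int]_2) : 0 < \det M ->
  vanishes_at_cusps k F -> vanishes_at_cusps k (slash k F (toR R M)).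
Proof.
move=> dM vF alpha Salpha.
have dMa : 0 < \det (M *m alpha) by rewrite det_mulmx Salpha mulr1.
have [alpha' Salpha' [A [D [B [A0 D0 MaE]]]]] := int_mat2_upper dMa.
have [h [h0 [a aF]]] := vF _ Salpha'.
exists (D * h)%N; split; first by rewrite muln_gt0 D0.
have -> : slash k (slash k F (toR R M)) (toR R alpha) =
    slash k (slash k F (toR R alpha')) (mat2 A%:R B%:~R 0 D%:R).
  rewrite slashM ?det_toR ?Salpha ?ltr0z // -toRM MaE toRM toR_mat2 -slashM //.
    by rewrite det_toR Salpha'.
  by rewrite det_mat2 !mat2E mulr0 subr0 mulr_gt0 ?ltr0n.
exact: has_qexp_upper aF.
Qed.

(** If T h = g T, then f | T | h = f | g | T = f | T. The hypothesis asks for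
    one inclusion of conjugates, so that the lemma serves both for beta and for
    its inverse. *)
Lemma cusp_form_conj (R : realType) (k : nat) (G H : set 'M[int]_2)
    (a b d : int) (F : upper_half R -> R[i]) :
  0 < a * d -> G `<=` SL2Z -> H `<=` SL2Z ->
  (forall h, H h -> exists2 g, G g & mat2 a b 0 d *m h = g *m mat2 a b 0 d) ->
  cusp_form k G F -> cusp_form k H (slash k F (toR R (mat2 a b 0 d))).
Proof.
move=> ad GS HS HG [holF invF vF].
have dT : 0 < \det (mat2 a b 0 d) by rewrite det_mat2 !mat2E mulr0 subr0.
split.
- by rewrite toR_mat2; apply: holomorphic_upper; rewrite // -intrM ltr0z.
- have dTR : 0 < \det (toR R (mat2 a b 0 d)) by rewrite det_toR ltr0z.
  move=> h Hh; have [g Gg gE] := HG h Hh.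
  have dg : 0 < \det (toR R g) by rewrite det_toR (GS g Gg).
  have dh : 0 < \det (toR R h) by rewrite det_toR (HS h Hh).
  by rewrite slashM // -toRM gE toRM -slashM // invF.
- exact: vanishes_at_cusps_slash.
Qed.

Lemma cusp_formZ (R : realType) (k : nat) (G : set 'M[int]_2) (c : R[i])
    (F : upper_half R -> R[i]) :
  cusp_form k G F -> cusp_form k G (c *: F).
Proof.
move=> [holF invF vF]; split.
- move=> tau.
  have -> : (fun z => (c *: F) (insubd tau z)) =
      (fun z => c * (fun w => F (insubd tau w)) (1 * z + 0)).
    by apply/funext => z; rewrite mul1r addr0.
  apply: (@derivable_affine_comp R[i] (fun w => F (insubd tau w))).
  by rewrite mul1r addr0; apply: holF.
- by move=> g Gg; rewrite slashZ invF.
- move=> alpha Sa; have [h [h0 [a aF]]] := vF alpha Sa.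
  exists h; split => //; exists (fun n => c * a n).
  by rewrite slashZ; exact: has_qexp_scale.
Qed.

(** * The substitution tau |-> tau / N *)

(** The powers N^(k/2) of the normalization and of det^(k/2) cancel N^-k. *)
Lemma betaE (R : realType) (k N : nat) (F : upper_half R -> R[i])
    (tau : upper_half R) : (0 < N)%N ->
  beta k N F tau = F (mobius (mat2 1 0 0 N%:R) tau).
Proof.
move=> N0; have N0R : (N%:R : R) != 0 by rewrite pnatr_eq0 -lt0n.
rewrite /beta -[LHS]/(_ * slash _ _ _ _) slash_upper mul1r mulrA mulrA.
rewrite -rmorphM -powRM ?ler0n // -expr2 powR_half_sqr ?ler0n // rmorphXn /= mulfV ?mul1r //.
by rewrite expf_neq0 // (fmorph_eq0 (real_complex R)).
Qed.

Lemma mul_contract_dilate (R : realType) (N : nat) :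
  mat2 1 0 0 N%:R *m mat2 N%:R 0 0 1 = N%:R *: (1%:M : 'M[R]_2).
Proof.
rewrite [RHS]mat2_eta mul_mat2 !mxE /=.
by rewrite !(mulr0, mul0r, mulr1, mul1r, addr0, add0r).
Qed.

Lemma mul_dilate_contract (R : realType) (N : nat) :
  mat2 N%:R 0 0 1 *m mat2 1 0 0 N%:R = N%:R *: (1%:M : 'M[R]_2).
Proof.
rewrite [RHS]mat2_eta mul_mat2 !mxE /=.
by rewrite !(mulr0, mul0r, mulr1, mul1r, addr0, add0r).
Qed.

Lemma det_diag (R : realType) (a d : nat) : (0 < a)%N -> (0 < d)%N ->
  0 < \det (mat2 (a%:R : R) 0 0 d%:R).
Proof. by move=> a0 d0; rewrite det_mat2 !mat2E mulr0 subr0 mulr_gt0 ?ltr0n. Qed.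

Lemma mobius_scalar (R : realType) (c : R) (tau : upper_half R) : 0 < c ->
  mobius (c *: (1%:M : 'M[R]_2)) tau = tau.
Proof.
move=> c0; have cC : c%:C != 0 :> R[i].
  by rewrite (fmorph_eq0 (real_complex R)) gt_eqF.
apply/val_inj; rewrite val_mobius ?detZ ?det1 ?mulr1 ?exprn_gt0 // !mxE /=.
by rewrite !mulr0 mulr1 mul0r add0r addr0 mulrAC mulfV ?mul1r.
Qed.

Lemma mobius_dilateK (R : realType) (N : nat) : (0 < N)%N ->
  cancel (@mobius R (mat2 N%:R 0 0 1)) (mobius (mat2 1 0 0 N%:R)).
Proof.
move=> N0 tau; have d1 := @det_diag R 1 N isT N0; have d2 := @det_diag R N 1 N0 isT.
by rewrite mobius_comp // mul_contract_dilate mobius_scalar ?ltr0n.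
Qed.

Lemma beta_linear (R : realType) (k N : nat) : linear (@beta R k N).
Proof.
by move=> c F G; rewrite /beta slash_lin scalerDr !scalerA mulrC.
Qed.

HB.instance Definition _ (R : realType) (k N : nat) :=
  GRing.isLinear.Build R[i] (upper_half R -> R[i]) (upper_half R -> R[i])
    *:%R (@beta R k N) (@beta_linear R k N).

Lemma beta_inj (R : realType) (k N : nat) : (0 < N)%N -> injective (@beta R k N).
Proof.
move=> N0 F G FG; apply/funext => tau; rewrite -(mobius_dilateK N0 tau).
by rewrite -(betaE k F) // -(betaE k G) // FG.
Qed.

(** The equivalence, rather than one implication, is what makes beta reflect
    integrality of the coefficients. *)
Lemma has_qexp_beta (R : realType) (k N : nat) (F : upper_half R -> R[i])
    (a : nat -> R[i]) : (0 < N)%N ->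
  has_qexp N a (beta k N F) <-> has_qexp 1 a F.
Proof.
move=> N0.
have qE (tau : upper_half R) :
    qpar 1 (mobius (mat2 1 0 0 N%:R) tau) = qpar N tau.
  rewrite /qpar val_mobius_upper ?mul1r ?ltr0n //.
  by rewrite addr0 divr1 mulrA rmorph_nat.
split=> aF tau; last by rewrite betaE // -qE; apply: aF.
rewrite -(mobius_dilateK N0 tau) -(betaE k F) // qE; exact: aF.
Qed.

(** * Conjugation of the two groups *)

Lemma Gamma_conj (N : nat) (h : 'M[int]_2) : (0 < N)%N -> Gamma N h ->
  exists2 g, (Gamma0 (N ^ 2) `&` Gamma1 N) g
    & mat2 1 0 0 N%:Z *m h = g *m mat2 1 0 0 N%:Z.
Proof.
move=> N0 [deth modh]; rewrite [X in _ *m X](mat2_eta h).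
move: deth (modh 0 0) (modh 1 1) (modh 0 1) (modh 1 0).
rewrite /SL2Z /= det_mat2 !mxE /=.
move: (h 0 0) (h 0 1) (h 1 0) (h 1 1) => a b c d deth a1 d1 b0 c0.
have /dvdzP[b' bE] : (N%:Z %| b)%Z.
  by rewrite -[b]subr0 -eqz_mod_dvd; apply/eqP.
have /dvdzP[c' cE] : (N%:Z %| c)%Z.
  by rewrite -[c]subr0 -eqz_mod_dvd; apply/eqP.
exists (mat2 a b' (N%:Z * c) d); last first.
  by rewrite !mul_mat2 bE; congr mat2; ring.
have detg : a * d - b' * (N%:Z * c) = 1 by rewrite -deth bE; ring.
rewrite /Gamma0 /Gamma1 /SL2Z /= det_mat2 !mat2E; split; split => //.
  by rewrite cE mulrC -mulrA dvdz_mull.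
exact: dvdz_mulr.
Qed.

Lemma Gamma0_Gamma1_conj (N : nat) (h : 'M[int]_2) : (0 < N)%N ->
  (Gamma0 (N ^ 2) `&` Gamma1 N) h ->
  exists2 g, Gamma N g & mat2 N%:Z 0 0 1 *m h = g *m mat2 N%:Z 0 0 1.
Proof.
move=> N0 [[deth c0] [_ _ a1 d1]]; rewrite [X in _ *m X](mat2_eta h).
move: deth c0 a1 d1; rewrite /SL2Z /= det_mat2.
move: (h 0 0) (h 0 1) (h 1 0) (h 1 1) => a b c d deth /dvdzP[c' cE] a1 d1.
exists (mat2 a (N%:Z * b) (c' * N%:Z) d); last first.
  by rewrite !mul_mat2 cE; congr mat2; rewrite ?PoszM; ring.
split; first by rewrite /SL2Z /= det_mat2 !mat2E -deth cE PoszM; ring.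
move=> i j; rewrite [mat2 _ _ _ _]lock.
case: i => -[|[|//]] i; case: j => -[|[|//]] j; rewrite -lock !mxE //=.
  by apply/eqP; rewrite eqz_mod_dvd subr0 dvdz_mulr.
by apply/eqP; rewrite eqz_mod_dvd subr0 dvdz_mull.
Qed.

(** * The map on cusp forms *)

Lemma cusp_form_beta (R : realType) (k N : nat) (F : upper_half R -> R[i]) :
  (0 < N)%N -> cusp_form k (Gamma0 (N ^ 2) `&` Gamma1 N) F ->
  cusp_form k (Gamma N) (beta k N F).
Proof.
move=> N0 cF; apply: cusp_formZ; rewrite -(toR_diag R 1 N).
apply: cusp_form_conj cF; rewrite ?mul1r ?ltz_nat //.
- by move=> g [[]].
- by move=> g [].
- by move=> h; apply: Gamma_conj.
Qed.

(** The preimage is the multiple of F | diag(N, 1) with the inverse constant,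
    since diag(N, 1) diag(1, N) is the scalar matrix N. *)
Lemma beta_surj (R : realType) (k N : nat) (F : upper_half R -> R[i]) :
  (0 < N)%N -> cusp_form k (Gamma N) F ->
  exists2 F', cusp_form k (Gamma0 (N ^ 2) `&` Gamma1 N) F' & beta k N F' = F.
Proof.
move=> N0 cF; pose c : R[i] := (N%:R `^ (k%:R / 2) : R)%:C.
have c0 : c != 0.
  by rewrite (fmorph_eq0 (real_complex R)) gt_eqF // powR_gt0 // ltr0n.
exists (c^-1 *: slash k F (mat2 N%:R 0 0 1)).
  apply: cusp_formZ; rewrite -(toR_diag R N 1).
  apply: cusp_form_conj cF; rewrite ?mulr1 ?ltz_nat //.
  - by move=> g [].
  - by move=> g [[]].
  - by move=> h; apply: Gamma0_Gamma1_conj.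
have d1 := @det_diag R 1 N isT N0; have d2 := @det_diag R N 1 N0 isT.
rewrite /beta slashZ scalerA divff // scale1r slashM // mul_dilate_contract.
by rewrite slash_scale ?slash1 ?det1 ?ltr0n.
Qed.

(** Slashing is an action in which positive scalars act trivially, so this comes
    down to (0 -1; N^2 0) diag(1, N) = N diag(1, N) S. The power N^k is the normalization (N^2)^(k/2) of W. *)
Lemma beta_atkin_lehner (R : realType) (k N : nat) (F : upper_half R -> R[i]) :
  (0 < N)%N ->
  beta k N (atkin_lehner k (N ^ 2) F) =
  (N%:R ^+ k) *: slash k (beta k N F) (mat2 0 (- 1) 1 0).
Proof.
move=> N0; have N0R : 0 < N%:R :> R by rewrite ltr0n.
have d1 := @det_diag R 1 N isT N0.
have dS : 0 < \det (mat2 0 (- 1) 1 0 : 'M[R]_2).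
  by rewrite det_mat2 !mat2E mul0r mulr1 sub0r opprK.
have dW : 0 < \det (mat2 0 (- 1) (N ^ 2)%:R 0 : 'M[R]_2).
  by rewrite det_mat2 !mat2E mul0r mulN1r sub0r opprK ltr0n expn_gt0 N0.
rewrite /beta /atkin_lehner !slashZ !slashM // !scalerA.
have -> : mat2 0 (- 1) (N ^ 2)%:R 0 *m mat2 1 0 0 N%:R =
    N%:R *: (mat2 1 0 0 N%:R *m mat2 0 (- 1) 1 0) :> 'M[R]_2.
  rewrite !mul_mat2 [RHS]mat2_eta !mxE /= natrX.
  by congr mat2; ring.
rewrite slash_scale ?det_mulmx ?mulr_gt0 //; congr (_ *: _).
by rewrite natrX powR_half_sqr ?ltW // rmorphXn /= rmorph_nat mulrC.
Qed.

Theorem mainTheorem2 (R : realType) (k N : nat) (hk : (1 <= k)%N)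
    (hN : (1 <= N)%N) (g : nat) (f : 'I_g -> (upper_half R -> R[i]))
    (hf : Zbasis (cusp_form_int k (Gamma0 (N ^ 2) `&` Gamma1 N) 1) f)
    (W : 'M[R[i]]_g) (hW : W \in unitmx)
    (hfW : forall j : 'I_g,
       atkin_lehner k (N ^ 2) (f j) = \sum_(i < g) W j i *: f i) :
  [/\ linear_iso (cusp_form k (Gamma0 (N ^ 2) `&` Gamma1 N))
        (cusp_form k (Gamma N)) (@beta R k N)
      /\ (forall (F : upper_half R -> R[i]) (a : nat -> R[i]),
            cusp_form k (Gamma0 (N ^ 2) `&` Gamma1 N) F ->
            has_qexp 1 a F -> has_qexp N a (beta k N F)),
      Zbasis (cusp_form_int k (Gamma N) N) (fun j => beta k N (f j))
    & (forall F : upper_half R -> R[i],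
         cusp_form k (Gamma0 (N ^ 2) `&` Gamma1 N) F ->
         beta k N (atkin_lehner k (N ^ 2) F) =
         (N%:R ^+ k) *: slash k (beta k N F) (mat2 0 (- 1) 1 0))
      /\ (forall j : 'I_g,
            slash k (beta k N (f j)) (mat2 0 (- 1) 1 0) =
            \sum_(i < g) (N%:R ^- k * W j i) *: beta k N (f i))].
Proof.
split; first split.
- split; first by move=> c u v _ _; exact: beta_linear.
  split.
  + by move=> F /=; exact: cusp_form_beta.
  + by move=> F G _ _; exact: beta_inj.
  + by move=> F /= cF; have [F' ? ?] := beta_surj hN cF; exists F'.
- by move=> F a _ aF; exact: (proj2 (has_qexp_beta k F a hN) aF).
- case: hf => fint ffree fspan.
  have betaS (c : 'I_g -> int) :
      beta k N (\sum_i f i *~ c i) = \sum_i beta k N (f i) *~ c i.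
    by rewrite raddf_sum; apply: eq_bigr => i _; rewrite raddfMz.
  split.
  + move=> i; have [cf [a af]] := fint i; split; first exact: cusp_form_beta.
    by exists a; exact: (proj2 (has_qexp_beta k (f i) _ hN) af).
  + move=> c; rewrite -betaS => betac0; apply: ffree.
    by apply: (@beta_inj R k N hN); rewrite betac0 raddf0.
  + move=> F [/(beta_surj hN)[F' cF' <-] [a aF]].
    have aF' := proj1 (has_qexp_beta k F' _ hN) aF.
    have [|c ->] := fspan F'; first by split=> //; exists a.
    by exists c; rewrite betaS.
- split; first by move=> F _; exact: beta_atkin_lehner.
  move=> j; have Nk0 : (N%:R ^+ k : R[i]) != 0.
    by rewrite expf_neq0 // pnatr_eq0 -lt0n.
  apply: (scalerI Nk0); rewrite -beta_atkin_lehner // hfW linear_sum scaler_sumr.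
  by apply: eq_bigr => i _; rewrite linearZ scalerA mulVKf.
Qed.
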